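(* Let $n\ge 1$, let $d_1,\ldots,d_n\ge 2$ be integers and $d=d_1d_2\cdots d_n$. Let $\mathcal{B}=\{|\psi_i^1\rangle\otimes|\psi_i^2\rangle\otimes\cdots\otimes|\psi_i^n\rangle : i=1,\ldots,d\}$ be an orthonormal product basis of $\mathbb{C}^d=\mathbb{C}^{d_1}\otimes\cdots\otimes\mathbb{C}^{d_n}$, with unit vectors $|\psi_i^r\rangle\in\mathbb{C}^{d_r}$, and let $|\mu^1\rangle\otimes\cdots\otimes|\mu^n\rangle$ be a product state with unit vectors $|\mu^r\rangle\in\mathbb{C}^{d_r}$. Then the product state $|\mu^1\rangle\otimes\cdots\otimes|\mu^n\rangle$ is mutually unbiased to $\mathcal{B}$ (in dimension $d$) if and only if, for each $r=1,\ldots,n$, the state $|\mu^r\rangle$ is mutually unbiased to $|\psi_i^r\rangle$ (in dimension $d_r$) for all $i=1,\ldots,d$.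
   Context: A product basis of $\mathbb{C}^{d_1}\otimes\cdots\otimes\mathbb{C}^{d_n}$ is an orthonormal basis each of whose vectors is a tensor product $|\psi^1\rangle\otimes\cdots\otimes|\psi^n\rangle$ with $|\psi^r\rangle\in\mathbb{C}^{d_r}$ (all factors taken to be unit vectors). It need not be a tensor product of bases of the factors. Two unit vectors $|\phi\rangle,|\psi\rangle\in\mathbb{C}^D$ are mutually unbiased (in dimension $D$) if $|\langle\phi|\psi\rangle|^2=1/D$. A unit vector is mutually unbiased to a basis of $\mathbb{C}^D$ if it is mutually unbiased to every vector of that basis. *)

(* Defs.v *)
From mathcomp Require Import all_boot all_order all_algebra.
From mathcomp Require Import complex.
From mathcomp Require Import reals.

Set Implicit Arguments.
Unset Strict Implicit.
Unset Printing Implicit Defensive.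

Import Order.TTheory GRing.Theory Num.Theory.
Local Open Scope ring_scope.

Lemma card_multi_index (n : nat) (d : 'I_n -> nat) :
  #|{dffun forall r : 'I_n, 'I_(d r)}| = (\prod_(r < n) d r)%N.
Proof.
rewrite card_dep_ffun foldrE big_image /=.
by apply: eq_bigr => r _; rewrite card_ord.
Qed.

(* The tensor product C^(d_1) (x) ... (x) C^(d_n) is identified with
   C^(d_1 ... d_n) by numbering the multi-indices (j_1, ..., j_n), hence the
   product vectors e_(j_1) (x) ... (x) e_(j_n) of the standard bases;
   [multi_index] is the enumeration bijection provided by [enum_val]. *)
Definition multi_index (n : nat) (d : 'I_n -> nat)
    (k : 'I_(\prod_(r < n) d r)) : {dffun forall r : 'I_n, 'I_(d r)} :=
  enum_val (cast_ord (esym (card_multi_index d)) k).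

Definition product_vector (C : numClosedFieldType) (n : nat) (d : 'I_n -> nat)
    (u : forall r : 'I_n, 'rV[C]_(d r)) : 'rV[C]_(\prod_(r < n) d r) :=
  \row_k \prod_(r < n) u r 0 (multi_index k r).

(* [dotmx u v = \sum_k u_k * (v_k)^*] is conjugate-linear in the second argument
   rather than the first; norms, orthogonality and overlap moduli are the same
   under either convention. *)
Definition unit_vector (C : numClosedFieldType) (D : nat) (u : 'rV[C]_D) : Prop :=
  dotmx u u = 1.

Definition orthonormal_basis (C : numClosedFieldType) (D : nat)
    (B : 'I_D -> 'rV[C]_D) : Prop :=
  orthonormal (@dotmx C D) [tuple B i | i < D] /\
  basis_of fullv [tuple B i | i < D].

(* Only meant for unit vectors, as in the usual definition. *)
Definition mutually_unbiased (C : numClosedFieldType) (D : nat)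
    (u v : 'rV[C]_D) : Prop :=
  `|dotmx u v| ^+ 2 = D%:R^-1.

Definition mutually_unbiased_to_basis (C : numClosedFieldType) (D : nat)
    (u : 'rV[C]_D) (B : 'I_D -> 'rV[C]_D) : Prop :=
  forall i, mutually_unbiased u (B i).

(* Main.v *)
Require Import Defs.
From mathcomp Require Import all_boot all_order all_algebra.
From mathcomp Require Import complex.
From mathcomp Require Import reals.

(** Put [x_i^r = d_r |<mu^r|psi_i^r>|^2].  Taking the trace of
    [|mu^r><mu^r| (x) Id] in the basis gives [\sum_i x_i^r = d] for each [r], so
    the numbers [\sum_r x_i^r] add up to [n d].  Unbiasedness of the product
    state says that [\prod_r x_i^r = 1] for each [i], so by AM-GM each
    [\sum_r x_i^r] is at least [n], with equality iff all [x_i^r] are [1].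
    Hence equality holds for each [i]. *)

Set Implicit Arguments.
Unset Strict Implicit.
Unset Printing Implicit Defensive.

Import Order.TTheory GRing.Theory Num.Theory.
Local Open Scope ring_scope.

(** Distributivity is available for non-dependent choice functions, so dependent families are
    encoded by functions into the tagged union of the [T i]. *)
Lemma sum_dffun_prod (A : comPzRingType) (I : finType) (T : I -> finType)
    (F : forall i, T i -> A) :
  \sum_(f : {dffun forall i, T i}) \prod_i F i (f i) =
  \prod_i \sum_(j : T i) F i j.
Proof.
rewrite (reindex (@dffun_of_fprod _ T)); last exact/onW_bij/dffun_of_fprod_bij.
pose P i : {ffun T i -> A} := [ffun j => F i j].
transitivity (\sum_(t : fprod T) \prod_(i in I) P i (t i)).
  by apply: eq_bigr => t _; apply: eq_bigr => i _; rewrite !ffunE.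
(* The default [0] of [untag] is never read: the [i]-th choice only ranges over elements tagged by
   [i]. *)
rewrite (big_fprod 1 +%R P) -(bigA_distr_big_dep _ (fun i j => untag 0 (P i) j)).
apply: eq_bigr => i _; rewrite -(big_tag (fun i => P i)).
by apply: eq_bigr => j _; rewrite ffunE.
Qed.

Lemma sum_multi_index (A : comPzRingType) (n : nat) (d : 'I_n -> nat)
    (F : forall r, 'I_(d r) -> A) :
  \sum_(k < \prod_(r < n) d r) \prod_r F r (multi_index k r) =
  \prod_r \sum_(j < d r) F r j.
Proof.
rewrite -sum_dffun_prod [RHS](reindex (@multi_index n d)) //.
apply: onW_bij; apply: bij_comp; first exact: enum_val_bij.
by exists (cast_ord (card_multi_index d)); [apply: cast_ordKV | apply: cast_ordK].
Qed.

Section Dot.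
Variable C : numClosedFieldType.

Lemma dotmx_sum (D : nat) (u v : 'rV[C]_D) :
  dotmx u v = \sum_k u 0 k * (v 0 k)^*.
Proof. by rewrite dotmxE mxE; apply: eq_bigr => k _; rewrite !mxE. Qed.

Lemma dotmx_product_vector (n : nat) (d : 'I_n -> nat)
    (u v : forall r, 'rV[C]_(d r)) :
  dotmx (product_vector u) (product_vector v) = \prod_r dotmx (u r) (v r).
Proof.
rewrite dotmx_sum; under [RHS]eq_bigr => r _ do rewrite dotmx_sum.
rewrite -(sum_multi_index (fun r j => u r 0 j * (v r 0 j)^*)).
by apply: eq_bigr => k _; rewrite !mxE rmorph_prod -big_split.
Qed.

Lemma sum_dotmx_delta (D : nat) (u : 'rV[C]_D) :
  \sum_j `|dotmx (delta_mx 0 j) u| ^+ 2 = dotmx u u.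
Proof.
rewrite [RHS]dotmx_sum; apply: eq_bigr => j _; rewrite -normCK dotmx_sum.
rewrite (bigD1 j) //= big1 ?addr0 => [|k /negPf nkj].
  by rewrite mxE !eqxx mul1r norm_conjC.
by rewrite mxE nkj andbF mul0r.
Qed.

(** The square matrix with rows [B i] is unitary, so passing from [v] to its coordinates [w]
    preserves the norm. *)
Lemma parseval (D : nat) (B : 'I_D -> 'rV[C]_D) (v : 'rV[C]_D) :
  orthonormal_basis B -> \sum_i `|dotmx v (B i)| ^+ 2 = dotmx v v.
Proof.
case=> [/orthonormalP [uB oB] _].
pose M := \matrix_i B i.
have MU : M \is unitarymx.
  apply/row_unitarymxP => i j; rewrite !rowK.
  have tE k : B k = tnth [tuple B i | i < D] k by rewrite tnth_mktuple.
  (* [oB] compares vectors, while unitarity compares indices; the absence of repetitions [uB]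
     identifies the two. *)
  rewrite oB; first by rewrite !tE (inj_eq (tuple_uniqP _ uB)).
    by rewrite tE mem_tnth.
  by rewrite tE mem_tnth.
pose w := v *m (M ^t*)%sesqui.
have wE i : w 0 i = dotmx v (B i).
  by rewrite mxE dotmx_sum; apply: eq_bigr => k _; rewrite !mxE.
under eq_bigr => i _ do rewrite -wE normCK.
rewrite -dotmx_sum !dotmxE /w trmx_mul map_mxM trmxCK mulmxA.
by rewrite mulmxKtV.
Qed.

(* The rank-one terms of the trace of [|mu^r><mu^r| (x) Id] are indexed by full
   multi-indices, the [r]-th entry being a dummy: hence the factor [d r]. *)
Lemma sum_overlap_factor (n : nat) (d : 'I_n -> nat)
    (psi : 'I_(\prod_(r < n) d r) -> forall r, 'rV[C]_(d r))
    (mu : forall r, 'rV[C]_(d r)) (r : 'I_n) :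
  (forall i r, unit_vector (psi i r)) ->
  orthonormal_basis (fun i => product_vector (psi i)) ->
  unit_vector (mu r) ->
  \sum_i (d r)%:R * `|dotmx (mu r) (psi i r)| ^+ 2 = (\prod_(r < n) d r)%:R.
Proof.
move=> psi1 onB mu1.
pose w s (j : 'I_(d s)) : 'rV[C]_(d s) := if s == r then mu s else delta_mx 0 j.
pose W k := product_vector (fun s => w s (multi_index k s)).
(* Double counting. For fixed [i], the sum over [k] factors: position [r] contributes [d r] equal
   terms, and any other position contributes the squared norm of [psi i s], which is 1. For fixed
   [k], the sum over [i] is the squared norm of [W k], again 1. *)
transitivity (\sum_i \sum_k `|dotmx (W k) (product_vector (psi i))| ^+ 2).
  apply: eq_bigr => i _.
  under [RHS]eq_bigr => k _ do rewrite dotmx_product_vector normr_prod -prodrXl.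
  rewrite (sum_multi_index (fun s j => `|dotmx (w s j) (psi i s)| ^+ 2)).
  rewrite (bigD1 r) //= [X in _ = _ * X]big1 => [|s nsr]; last first.
    by rewrite /w (negPf nsr) sum_dotmx_delta psi1.
  by rewrite mulr1 /w eqxx sumr_const card_ord mulr_natl.
rewrite exchange_big /=.
under eq_bigr => k _ do rewrite (parseval _ onB) dotmx_product_vector.
rewrite (eq_bigr (fun=> 1)) ?sumr_const ?card_ord // => k _.
apply: big1 => s _; rewrite /w; have [-> //|_] := eqVneq s r.
rewrite dotmx_sum (bigD1 (multi_index k s)) //= big1 => [|j /negPf njk].
  by rewrite mxE !eqxx conjC1 mulr1 addr0.
by rewrite mxE njk andbF mul0r.
Qed.

Lemma leif_sum_prod1 (I : finType) (x : I -> C) :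
  (forall i, 0 <= x i) -> \prod_i x i = 1 ->
  #|I|%:R <= \sum_i x i ?= iff [forall i, x i == 1].
Proof.
move=> x0 x1.
(* The arithmetic mean needs a nonzero cardinal; for empty [I] both sides are 0 and the condition is
   vacuous. *)
have [I0|I_gt0] := posnP #|I|.
  have Ie (i : I) : false by rewrite -(ltnn #|I|) {1}I0; apply/card_gt0P; exists i.
  rewrite I0 big1 => [|i]; last by have := Ie i.
  by apply/leifP; case: forallP => // -[] i; have := Ie i.
have n0 : (0 : C) < #|I|%:R by rewrite ltr0n.
have S0 : 0 <= \sum_i x i by apply: sumr_ge0.
have [le1 eq1] : 1 <= ((\sum_i x i) / #|I|%:R) ^+ #|I|
    ?= iff [forall i in I, forall j in I, x i == x j].
  by rewrite -{1}x1; apply: leif_AGM.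
have m0 : 0 <= (\sum_i x i) / #|I|%:R by rewrite divr_ge0 // ltW.
have le : #|I|%:R <= \sum_i x i.
  by rewrite -[_%:R]mul1r -ler_pdivlMr // -(expr_ge1 I_gt0 m0).
split=> //; apply/eqP/forallP => [SE i|xE]; last first.
  by rewrite (eq_bigr (fun=> 1)) ?sumr_const // => i _; apply/eqP.
(* The mean is now 1, so this is the equality case of AM-GM: all [x j] coincide, and their sum
   [#|I|] forces the common value 1. *)
move: eq1; rewrite -SE divff ?(gt_eqF n0) // expr1n eqxx => /esym/forallP eqx.
have xE j : x j = x i.
  by have /implyP/(_ isT)/forallP/(_ j)/implyP/(_ isT)/eqP := eqx i.
move: SE; rewrite (eq_bigr (fun=> x i)) // sumr_const => SE.
by rewrite -(inj_eq (mulIf (lt0r_neq0 n0))) mul1r mulr_natr -SE.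
Qed.

Lemma product_vector_unbiased (n : nat) (d : 'I_n -> nat)
    (psi : 'I_(\prod_(r < n) d r) -> forall r, 'rV[C]_(d r))
    (mu : forall r, 'rV[C]_(d r)) :
  (forall r, (0 < d r)%N) ->
  (forall i r, unit_vector (psi i r)) ->
  orthonormal_basis (fun i => product_vector (psi i)) ->
  (forall r, unit_vector (mu r)) ->
  mutually_unbiased_to_basis (product_vector mu)
    (fun i => product_vector (psi i))
  <-> forall r i, mutually_unbiased (mu r) (psi i r).
Proof.
move=> d0 psi1 onB mu1.
have dotE i : `|dotmx (product_vector mu) (product_vector (psi i))| ^+ 2 =
    \prod_r `|dotmx (mu r) (psi i r)| ^+ 2.
  by rewrite dotmx_product_vector normr_prod prodrXl.
have dn0 r : (d r)%:R != 0 :> C by rewrite pnatr_eq0 -lt0n.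
split=> [unb|unb i]; last first.
  rewrite /mutually_unbiased dotE natr_prod -prodfV.
  by apply: eq_bigr => r _; apply: unb.
pose x i r : C := (d r)%:R * `|dotmx (mu r) (psi i r)| ^+ 2.
have agm i : n%:R <= \sum_r x i r ?= iff [forall r, x i r == 1].
  rewrite -[n in n%:R]card_ord; apply: leif_sum_prod1 => [r|].
    by rewrite mulr_ge0 ?ler0n ?exprn_ge0.
  rewrite big_split /= -dotE unb -natr_prod divff //.
  by rewrite natr_prod; apply/prodf_neq0.
(* Only the equality condition of the summed inequality is kept: once both totals are evaluated to
   [n] times the full dimension, it yields equality for every [i]. *)
have [_ /esym] := leif_sum (fun i (_ : predT i) => agm i).
rewrite exchange_big /= [X in _ == X](eq_bigr (fun=> (\prod_(r < n) d r)%:R));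
  last by move=> r _; apply: sum_overlap_factor.
rewrite !sumr_const !card_ord -!mulrnA mulnC eqxx.
move=> /forallP xE r i; have /forallP/(_ r)/eqP xir := xE i.
by apply: (mulfI (dn0 r)); rewrite divff.
Qed.

End Dot.

Theorem theorem1 (R : realType) (n : nat) (hn : (1 <= n)%N)
    (d : 'I_n -> nat) (hd : forall r : 'I_n, (2 <= d r)%N)
    (psi : 'I_(\prod_(r < n) d r) -> forall r : 'I_n, 'rV[R[i]]_(d r))
    (hpsi : forall i r, unit_vector (psi i r))
    (hB : orthonormal_basis (fun i => product_vector (psi i)))
    (mu : forall r : 'I_n, 'rV[R[i]]_(d r))
    (hmu : forall r, unit_vector (mu r)) :
  mutually_unbiased_to_basis (product_vector mu)
    (fun i => product_vector (psi i))
  <-> forall r i, mutually_unbiased (mu r) (psi i r).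
Proof. by apply: product_vector_unbiased => // r; apply: ltnW. Qed.
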